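(* Let $\mu$ denote the minimum of $\tau(G)$ over all finite simple graphs $G$ with at least one edge. Then $\frac{3}{2}\le \mu<2$.
   Context: A vertex colouring $\varphi$ of a graph $G$ is a Thue colouring if there is no integer $m\ge 1$ and no path $v_1\cdots v_{2m}$ in $G$ (distinct vertices, consecutive ones adjacent) with $\varphi(v_i)=\varphi(v_{i+m})$ for all $1\le i\le m$. The Thue chromatic number $\pi(G)$ is the minimum number of colours in a Thue colouring of $G$ (for disconnected $G$, the maximum over components). For a graph $G$ with $\epsilon$ edges, an edge deletion sequence is an ordering $(f_1,\dots,f_\epsilon)$ of $E(G)$; it defines $G^*_0=G$ and $G^*_i=G^*_{i-1}-f_i$ for $1\le i\le\epsilon$ (vertices are kept), and its $\tau$-value is $\frac{1}{\epsilon+1}\sum_{i=0}^{\epsilon}\pi(G^*_i)$. The $\tau$-index $\tau(G)$ is the minimum of the $\tau$-values over all $\epsilon!$ edge deletion sequences. *)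

(* Defs.v *)
From HB Require Import structures.
From mathcomp Require Import all_boot all_order all_algebra.
From mathcomp Require Import boolp.

Set Implicit Arguments.
Unset Strict Implicit.
Unset Printing Implicit Defensive.

Import Order.TTheory GRing.Theory Num.Theory.

(* Finite simple graphs.  The vertex type is a parameter, so that the graphs
   obtained by deleting edges all live in one type. *)
Record sgraph (V : finType) := SGraph {
  adj : rel V;
  adj_sym : symmetric adj;
  adj_irrefl : irreflexive adj
}.

Definition edges (V : finType) (G : sgraph V) : {set {set V}} :=
  [set [set p.1; p.2] | p in [set p : V * V | adj G p.1 p.2]].

Definition del_adj (V : finType) (G : sgraph V) (f : {set V}) : rel V :=
  [rel x y | adj G x y && ([set x; y] != f)].

Lemma del_adj_sym (V : finType) (G : sgraph V) (f : {set V}) :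
  symmetric (del_adj G f).
Proof. by move=> x y; rewrite /del_adj /= adj_sym setUC. Qed.

Lemma del_adj_irrefl (V : finType) (G : sgraph V) (f : {set V}) :
  irreflexive (del_adj G f).
Proof. by move=> x; rewrite /del_adj /= adj_irrefl. Qed.

Definition del_edge (V : finType) (G : sgraph V) (f : {set V}) : sgraph V :=
  SGraph (@del_adj_sym V G f) (@del_adj_irrefl V G f).

Definition induced_adj (V : finType) (G : sgraph V) (A : {set V}) :
    rel {x : V | x \in A} :=
  [rel x y | adj G (val x) (val y)].

Lemma induced_adj_sym (V : finType) (G : sgraph V) (A : {set V}) :
  symmetric (@induced_adj V G A).
Proof. by move=> x y; rewrite /induced_adj /= adj_sym. Qed.

Lemma induced_adj_irrefl (V : finType) (G : sgraph V) (A : {set V}) :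
  irreflexive (@induced_adj V G A).
Proof. by move=> x; rewrite /induced_adj /= adj_irrefl. Qed.

Definition induced (V : finType) (G : sgraph V) (A : {set V}) :
    sgraph {x : V | x \in A} :=
  SGraph (@induced_adj_sym V G A) (@induced_adj_irrefl V G A).

Definition components (V : finType) (G : sgraph V) : {set {set V}} :=
  [set [set y | connect (adj G) x y] | x : V].

Definition is_path (V : finType) (G : sgraph V) (n : nat) (v : 'I_n -> V) :
    Prop :=
  injective v /\ forall i j : 'I_n, j = i.+1 :> nat -> adj G (v i) (v j).

(* [lshift m i] and [rshift m i] have values [i] and [m + i]. *)
Definition thue_colouring (V : finType) (G : sgraph V) (C : Type)
    (phi : V -> C) : Prop :=
  ~ exists (m : nat) (v : 'I_(m + m) -> V),
      [/\ (1 <= m)%N, is_path G v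
        & forall i : 'I_m, phi (v (lshift m i)) = phi (v (rshift m i))].

Definition thue_colourable (V : finType) (G : sgraph V) (k : nat) : bool :=
  `[< exists phi : V -> 'I_k, thue_colouring G phi >].

Lemma ex_thue_colourable (V : finType) (G : sgraph V) :
  exists k, thue_colourable G k.
Proof.
exists #|V|; apply/asboolP; exists enum_rank => -[m [v [m_gt0 [v_inj _] vE]]].
have /enum_rank_inj/v_inj/(congr1 val)/= := vE (Ordinal m_gt0).
by rewrite addn0 => m0; rewrite -m0 in m_gt0.
Qed.

Definition min_thue_colours (V : finType) (G : sgraph V) : nat :=
  ex_minn (ex_thue_colourable G).

(* A connected graph has itself as its only component, so the maximum over
   the components covers the connected and the disconnected case alike. *)
Definition thue_number (V : finType) (G : sgraph V) : nat :=
  \max_(A in components G) min_thue_colours (induced G A).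

Definition edge_deletion_sequence (V : finType) (G : sgraph V)
    (s : seq {set V}) : bool :=
  perm_eq s (enum (edges G)).

Definition del_stage (V : finType) (G : sgraph V) (s : seq {set V}) (i : nat) :
    sgraph V :=
  foldl (@del_edge V) G (take i s).

Local Open Scope ring_scope.

Definition tau_value (V : finType) (G : sgraph V) (s : seq {set V}) : rat :=
  (\sum_(i < #|edges G|.+1) (thue_number (del_stage G s i))%:R)
    / #|edges G|.+1%:R.

Definition is_min (S : rat -> Prop) (x : rat) : Prop :=
  S x /\ forall y : rat, S y -> x <= y.

(* The tuples of length [#|edges G|] form a finite type containing every edge
   deletion sequence; [enum (edges G)] is one of them, so the minimum is taken
   over a nonempty set and its value does not depend on this witness. *)
Definition tau (V : finType) (G : sgraph V) : rat :=
  \big[Num.min/tau_value G (enum (edges G))]_(s : #|edges G|.-tuple {set V}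
     | edge_deletion_sequence G s) tau_value G s.

Definition is_tau_index (x : rat) : Prop :=
  exists (V : finType) (G : sgraph V), edges G != set0 /\ x = tau G.

(* Main.v *)
Require Import Defs.
From HB Require Import structures.
From mathcomp Require Import all_boot all_order all_algebra.
From mathcomp Require Import boolp.
From mathcomp Require Import lra.

(** A graph with an edge has Thue number at least 2, and a nonempty graph has
    Thue number at least 1.  Hence every deletion sequence of a graph with [e]
    edges has tau-value at least [(2 * e + 1) / (e + 1) >= 3 / 2], and a single
    edge attains this bound, so the minimum exists and equals [3 / 2]. *)

Set Implicit Arguments.
Unset Strict Implicit.
Unset Printing Implicit Defensive.

Import Order.TTheory GRing.Theory Num.Theory.
Local Open Scope ring_scope.

Section ThueNumber.
Variables (V : finType) (G : sgraph V).

Lemma min_thue_coloursP :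
  exists phi : V -> 'I_(min_thue_colours G), thue_colouring G phi.
Proof. by rewrite /min_thue_colours; case: ex_minnP => k /asboolP. Qed.

(** Giving every vertex its own colour is a Thue colouring: a repetition would make the path
    vertices at indices [0] and [m] coincide, forcing [m = 0]. *)
Lemma min_thue_colours_le_card : (min_thue_colours G <= #|V|)%N.
Proof.
rewrite /min_thue_colours; case: ex_minnP => k _; apply.
apply/asboolP; exists enum_rank => -[m [v [m_gt0 [v_inj _] vE]]].
have /enum_rank_inj/v_inj/(congr1 val)/= := vE (Ordinal m_gt0).
by rewrite addn0 => m0; rewrite -m0 in m_gt0.
Qed.

Lemma min_thue_colours_gt0 (x : V) : (0 < min_thue_colours G)%N.
Proof.
have [phi _] := min_thue_coloursP.
exact: leq_ltn_trans (leq0n _) (ltn_ord (phi x)).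
Qed.

(** An edge is a path on two vertices, so equal colours at its ends would be a repetition with
    [m = 1]. *)
Lemma thue_colouring_adj (C : Type) (phi : V -> C) (x y : V) :
  thue_colouring G phi -> adj G x y -> phi x <> phi y.
Proof.
move=> phiP xy exy; apply: phiP.
exists 1%N, (fun i : 'I_(1 + 1) => if val i == 0%N then x else y).
split=> //.
  have x_neq_y : x <> y by move=> e; rewrite e adj_irrefl in xy.
  split=> [[[|[|i]] Hi] [[|[|j]] Hj]|[[|[|i]] Hi] [[|[|j]] Hj]] //= e.
  - exact: val_inj.
  - by case: x_neq_y.
  - exact: val_inj.
by case=> [[|i] Hi].
Qed.

Lemma min_thue_colours_adj (x y : V) :
  adj G x y -> (1 < min_thue_colours G)%N.
Proof.
move=> xy; have [phi phiP] := min_thue_coloursP.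
have := thue_colouring_adj phiP xy.
case: (min_thue_colours G) phi {phiP} => [|[|k]] // phi; first by case: (phi x).
by rewrite (ord1 (phi x)) (ord1 (phi y)).
Qed.

End ThueNumber.

Section ThueNumberBounds.
Variables (V : finType) (G : sgraph V).

(** The vertex [x] rules out the empty graph, whose maximum over no components is 0. *)
Lemma thue_number_gt0 (x : V) : (0 < thue_number G)%N.
Proof.
set A := [set y | connect (adj G) x y].
have xA : x \in A by rewrite inE connect0.
have AG : A \in components G by apply/imsetP; exists x.
apply: leq_trans (leq_bigmax_cond _ AG).
exact: (min_thue_colours_gt0 _ (exist _ x xA)).
Qed.

(** Both ends of an edge lie in one component, so the edge survives in the induced graph. *)
Lemma thue_number_adj (x y : V) : adj G x y -> (1 < thue_number G)%N.
Proof.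
move=> xy; set A := [set y | connect (adj G) x y].
have xA : x \in A by rewrite inE connect0.
have yA : y \in A by rewrite inE connect1.
have AG : A \in components G by apply/imsetP; exists x.
apply: leq_trans (leq_bigmax_cond _ AG).
exact: (@min_thue_colours_adj _ _ (exist _ x xA) (exist _ y yA)).
Qed.

Lemma thue_number_le (n : nat) :
  (forall A, A \in components G -> (#|A| <= n)%N) -> (thue_number G <= n)%N.
Proof.
move=> An; apply/bigmax_leqP => A /An; apply: leq_trans.
by rewrite -(card_sig (mem A)); apply: min_thue_colours_le_card.
Qed.

Lemma thue_number_le_card : (thue_number G <= #|V|)%N.
Proof. by apply: thue_number_le => A _; apply: max_card. Qed.

Lemma thue_number_edgeless :
  (forall x y, ~~ adj G x y) -> (thue_number G <= 1)%N.
Proof.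
move=> G0; apply: thue_number_le => _ /imsetP[x _ ->].
rewrite -(cards1 x); apply/subset_leq_card/subsetP => y.
(* A nontrivial walk from [x] would begin with an edge, so the component of [x] is a singleton. *)
rewrite !inE => /connectP[[|z p] /= + ->] //.
by rewrite (negPf (G0 _ _)).
Qed.

End ThueNumberBounds.

Lemma mem_edges (V : finType) (G : sgraph V) (x y : V) :
  adj G x y -> [set x; y] \in edges G.
Proof. by move=> xy; apply/imsetP; exists (x, y); rewrite ?inE. Qed.

Lemma adj_foldl_del (V : finType) (G : sgraph V) (s : seq {set V}) (x y : V) :
  adj (foldl (@del_edge V) G s) x y = adj G x y && ([set x; y] \notin s).
Proof.
elim: s G => [|f s IHs] G /=; first by rewrite andbT.
by rewrite IHs inE negb_or andbA.
Qed.

Section TauBounds.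
Variables (V : finType) (G : sgraph V) (s : seq {set V}).
Hypothesis sP : edge_deletion_sequence G s.

Lemma size_edge_deletion_sequence : size s = #|edges G|.
Proof. by rewrite (perm_size sP) -cardE. Qed.

(** The edge due to be deleted next, [nth set0 s i], is still present: [s] has no repeated entry, so
    it does not occur in [take i s]. *)
Lemma thue_number_stage (i : nat) :
  (i < #|edges G|)%N -> (1 < thue_number (del_stage G s i))%N.
Proof.
rewrite -size_edge_deletion_sequence => i_lt.
have : nth set0 s i \in edges G.
  by rewrite -mem_enum -(perm_mem sP) mem_nth.
case/imsetP=> -[x y]; rewrite inE /= => xy si.
apply: (@thue_number_adj _ _ x y).
rewrite adj_foldl_del xy -si /=.
have: uniq s by rewrite (perm_uniq sP) enum_uniq.
rewrite -{1}(cat_take_drop i s) (drop_nth set0) // cat_uniq /= negb_or.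
by case/and3P => _ /andP[].
Qed.

Lemma tau_value_ge : edges G != set0 -> 3 / 2 <= tau_value G s.
Proof.
case/set0Pn=> f fG; have e_gt0 : (0 < #|edges G|)%N by apply/card_gt0P; exists f.
have [[x _] _ _] := imsetP fG.
(* The final stage is split off: it has lost all edges and contributes at least 1, each earlier
   stage at least 2. *)
rewrite /tau_value -natr_sum big_ord_recr /=; set t := (_ + _)%N.
have : (2 * #|edges G| + 1 <= t)%N.
  apply: leq_add; last exact: thue_number_gt0.
  rewrite mulnC -{1}(card_ord #|edges G|) -sum_nat_const.
  by apply: leq_sum => i _; apply: thue_number_stage.
rewrite -(ler_nat rat) natrD natrM => t_ge.
rewrite ler_pdivlMr ?ltr0n // -natr1.
(* With [e] edges, [2 * e + 1 >= 3 / 2 * (e + 1)] amounts to [e >= 1]. *)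
have : 1 <= #|edges G|%:R :> rat by rewrite ler1n.
by lra.
Qed.

End TauBounds.

Lemma tau_ge (V : finType) (G : sgraph V) :
  edges G != set0 -> 3 / 2 <= tau G.
Proof.
(* The default value of the minimum needs the bound too; it comes from the sequence
   [enum (edges G)]. *)
move=> G0; apply: le_bigmin => [|s sP]; apply: tau_value_ge => //.
exact: perm_refl.
Qed.

Definition K2_adj : rel bool := [rel x y | x != y].

Lemma K2_adj_sym : symmetric K2_adj.
Proof. by do 2!case. Qed.

Lemma K2_adj_irrefl : irreflexive K2_adj.
Proof. by case. Qed.

Definition K2 : sgraph bool := SGraph K2_adj_sym K2_adj_irrefl.

Lemma edges_K2 : edges K2 = [set [set: bool]].
Proof.
have xyT (x y : bool) : x != y -> [set x; y] = setT.
  by move=> xy; apply/setP => z; rewrite !inE; case: x y z xy => [] [] [].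
apply/setP => f; rewrite inE; apply/imsetP/eqP => [[[x y]]|->].
  by rewrite inE => /xyT + ->.
by exists (true, false); rewrite ?inE ?xyT.
Qed.

Lemma tau_K2 : tau K2 = 3 / 2.
Proof.
apply/eqP; rewrite eq_le tau_ge ?andbT; last first.
  by apply/set0Pn; exists setT; rewrite edges_K2 inE.
(* The minimum is at most its default value, so only the sequence [enum (edges K2)] is evaluated. *)
apply: le_trans (bigmin_le_id _ _ _ _) _.
rewrite /tau_value -natr_sum big_ord_recr /= edges_K2 cards1 big_ord1.
(* The numerator 3 splits as 2 for the intact graph on two vertices and 1 for the edgeless last
   stage. *)
rewrite ler_pM2r ?invr_gt0 // ler_nat (@leq_add _ _ 2 1) //.
  by rewrite -card_bool thue_number_le_card.
apply: thue_number_edgeless => x y.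
rewrite adj_foldl_del take_oversize ?enum_set1 // inE.
by apply/negP => /andP[/mem_edges]; rewrite edges_K2 inE => ->.
Qed.

Theorem theorem2p4 :
  exists mu : rat, is_min is_tau_index mu /\ 3 / 2 <= mu < 2.
Proof.
exists (3 / 2); split; last by lra.
split=> [|_ [V [G [G0 ->]]]]; last exact: tau_ge.
exists bool, K2; split; last by rewrite tau_K2.
by apply/set0Pn; exists setT; rewrite edges_K2 inE.
Qed.
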